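(* Let $\mathbb{F}$ be a field of characteristic zero. For $n\ge1$, let $\overline{\Psi}_n\in\mathfrak{U}(\mathfrak{gl}_{n+1}(\mathbb{F}))$ be defined recursively by $\overline\Psi_1=F_1$ and, for $n\ge2$, $$\overline\Psi_n=F_1\,\overline\Psi_{n-1}^{+}\,(H_2-H_{n+1}+n-1)-\overline\Psi_{n-1}^{+}\,F_1\,(H_2-H_{n+1}+n-2).$$ Let $S_{1,n+1}\in\mathfrak{U}(\mathfrak{gl}_{n+1}(\mathbb{F}))$ be Carter's lowering operator and let $\sigma_n$ be the automorphism of $\mathfrak{U}(\mathfrak{gl}_{n+1}(\mathbb{F}))$ given by $E_i\mapsto E_{n+1-i}$, $F_i\mapsto F_{n+1-i}$ ($1\le i\le n$), $H_j\mapsto-H_{n+2-j}$ ($1\le j\le n+1$). Then for all $n\ge1$, $$\sigma_n(\overline\Psi_n)=S_{1,n+1}$$ in $\mathfrak{U}(\mathfrak{gl}_{n+1}(\mathbb{F}))$.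
   Context: $\mathfrak{U}(\mathfrak{gl}_N(\mathbb{F}))$ is the universal enveloping algebra. Let $e_{i,j}$ denote the matrix units, $H_i=e_{i,i}$, $E_i=e_{i,i+1}$, $F_i=e_{i+1,i}$, and $F_{i,j}=e_{j,i}$ for $i<j$ (so $F_{i,i+1}=F_i$). The shift $+:\mathfrak{U}(\mathfrak{gl}_n(\mathbb{F}))\to\mathfrak{U}(\mathfrak{gl}_{n+1}(\mathbb{F}))$ is the algebra homomorphism with $F_i\mapsto F_{i+1}$, $E_i\mapsto E_{i+1}$, $H_j\mapsto H_{j+1}$; $x^+$ denotes the image of $x$. Carter's lowering operator: put $C_{i,j}=H_i-H_j+j-i$. Then $S_{1,n+1}$ is the determinant of the $n\times n$ matrix $M$ with entries $M_{s,t}=F_{s,t+1}$ if $s\le t$, $M_{s,t}=-C_{1,s}$ if $s=t+1$, and $M_{s,t}=0$ if $s>t+1$. The determinant of a matrix over a noncommutative ring is defined by $\det M=\sum_{\pi\in\mathfrak{S}_n}\mathrm{sgn}(\pi)\,M_{1,\pi(1)}M_{2,\pi(2)}\cdots M_{n,\pi(n)}$ (factors in order of rows). *)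

(* Defs.v *)
From HB Require Import structures.
From mathcomp Require Import all_boot all_order all_fingroup all_algebra.
From mathcomp Require Import generic_quotient.
From mathcomp Require Import boolp zify.

Set Implicit Arguments.
Unset Strict Implicit.
Unset Printing Implicit Defensive.

Import GRing.Theory.
Local Open Scope ring_scope.

(* U(gl_N(F)) by generators and relations: formal F-algebra expressions in    *)
(* the elements of 'M[F]_N, modulo the congruence generated by the axioms of  *)
(* unital associative algebras, the linearity of 'M[F]_N -> U(gl_N(F)), and   *)
(* [x, y] = x y - y x. Its universal property is Ulift, Ulift_iota and Uext.  *)
Section EnvelopingAlgebra.
Variables (F : fieldType) (N : nat).

Inductive uterm : Type :=
| TVar of 'M[F]_N
| TZero
| TOne
| TOpp of uterm
| TAdd of uterm & uterm
| TMul of uterm & uterm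
| TScale of F & uterm.

Inductive ueqv : uterm -> uterm -> Prop :=
| ueqv_refl t : ueqv t t
| ueqv_sym t u : ueqv t u -> ueqv u t
| ueqv_trans t u v : ueqv t u -> ueqv u v -> ueqv t v
| ueqv_opp t t' : ueqv t t' -> ueqv (TOpp t) (TOpp t')
| ueqv_add t t' u u' :
    ueqv t t' -> ueqv u u' -> ueqv (TAdd t u) (TAdd t' u')
| ueqv_mul t t' u u' :
    ueqv t t' -> ueqv u u' -> ueqv (TMul t u) (TMul t' u')
| ueqv_scale a t t' : ueqv t t' -> ueqv (TScale a t) (TScale a t')
| ueqv_addA t u v : ueqv (TAdd t (TAdd u v)) (TAdd (TAdd t u) v)
| ueqv_addC t u : ueqv (TAdd t u) (TAdd u t)
| ueqv_add0 t : ueqv (TAdd TZero t) t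
| ueqv_addN t : ueqv (TAdd (TOpp t) t) TZero
| ueqv_mulA t u v : ueqv (TMul t (TMul u v)) (TMul (TMul t u) v)
| ueqv_mul1 t : ueqv (TMul TOne t) t
| ueqv_1mul t : ueqv (TMul t TOne) t
| ueqv_mulDl t u v :
    ueqv (TMul (TAdd t u) v) (TAdd (TMul t v) (TMul u v))
| ueqv_mulDr t u v :
    ueqv (TMul t (TAdd u v)) (TAdd (TMul t u) (TMul t v))
| ueqv_scaleA a b t : ueqv (TScale a (TScale b t)) (TScale (a * b) t)
| ueqv_scale1 t : ueqv (TScale 1 t) t
| ueqv_scaleDr a t u :
    ueqv (TScale a (TAdd t u)) (TAdd (TScale a t) (TScale a u))
| ueqv_scaleDl a b t :
    ueqv (TScale (a + b) t) (TAdd (TScale a t) (TScale b t))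
| ueqv_scaleAl a t u : ueqv (TScale a (TMul t u)) (TMul (TScale a t) u)
| ueqv_scaleAr a t u : ueqv (TScale a (TMul t u)) (TMul t (TScale a u))
| ueqv_linear a x y :
    ueqv (TVar (a *: x + y)) (TAdd (TScale a (TVar x)) (TVar y))
| ueqv_bracket x y :
    ueqv (TVar (x *m y - y *m x))
         (TAdd (TMul (TVar x) (TVar y)) (TOpp (TMul (TVar y) (TVar x)))).

HB.instance Definition _ := gen_eqMixin uterm.
HB.instance Definition _ := gen_choiceMixin uterm.

Definition ueqvb : rel uterm := fun t u => `[< ueqv t u >].

Lemma ueqvb_refl : reflexive ueqvb.
Proof. by move=> t; apply/asboolP/ueqv_refl. Qed.

Lemma ueqvb_sym : symmetric ueqvb.
Proof. by move=> t u; apply/asboolP/asboolP; apply: ueqv_sym. Qed.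

Lemma ueqvb_trans : transitive ueqvb.
Proof.
by move=> u t v /asboolP tu /asboolP uv; apply/asboolP; apply: ueqv_trans tu uv.
Qed.

Canonical ueqvb_equiv := EquivRel ueqvb ueqvb_refl ueqvb_sym ueqvb_trans.

Local Open Scope quotient_scope.

Definition Ugl : Type := {eq_quot ueqvb}.
HB.instance Definition _ := Choice.on Ugl.
HB.instance Definition _ := EqQuotient.on Ugl.

Lemma Upi_eq t u : ueqv t u -> \pi_Ugl t = \pi_Ugl u.
Proof. by move=> tu; apply/eqmodP/asboolP. Qed.

Lemma Upi_inv t u : \pi_Ugl t = \pi_Ugl u -> ueqv t u.
Proof. by move=> /eqmodP/asboolP. Qed.

Lemma Urepr t : ueqv (repr (\pi_Ugl t)) t.
Proof. by apply: Upi_inv; rewrite reprK. Qed.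

Lemma Upi_ind (P : Ugl -> Prop) : (forall t, P (\pi_Ugl t)) -> forall u, P u.
Proof. by move=> Ppi u; rewrite -[u]reprK; apply: Ppi. Qed.

Definition Uzero : Ugl := \pi_Ugl TZero.
Definition Uone : Ugl := \pi_Ugl TOne.
Definition Uopp (u : Ugl) : Ugl := \pi_Ugl (TOpp (repr u)).
Definition Uadd (u v : Ugl) : Ugl := \pi_Ugl (TAdd (repr u) (repr v)).
Definition Umul (u v : Ugl) : Ugl := \pi_Ugl (TMul (repr u) (repr v)).
Definition Uscale (a : F) (u : Ugl) : Ugl := \pi_Ugl (TScale a (repr u)).

Lemma Upi_opp t : Uopp (\pi_Ugl t) = \pi_Ugl (TOpp t).
Proof. by apply/Upi_eq/ueqv_opp/Urepr. Qed.
Lemma Upi_add t u : Uadd (\pi_Ugl t) (\pi_Ugl u) = \pi_Ugl (TAdd t u).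
Proof. by apply/Upi_eq/ueqv_add; apply: Urepr. Qed.
Lemma Upi_mul t u : Umul (\pi_Ugl t) (\pi_Ugl u) = \pi_Ugl (TMul t u).
Proof. by apply/Upi_eq/ueqv_mul; apply: Urepr. Qed.
Lemma Upi_scale a t : Uscale a (\pi_Ugl t) = \pi_Ugl (TScale a t).
Proof. by apply/Upi_eq/ueqv_scale/Urepr. Qed.
Let UpiE := (Upi_opp, Upi_add, Upi_mul, Upi_scale).

Fixpoint ueval (A : algType F) (f : 'M[F]_N -> A) (t : uterm) : A :=
  match t with
  | TVar x => f x
  | TZero => 0
  | TOne => 1
  | TOpp t => - ueval f t
  | TAdd t u => ueval f t + ueval f u
  | TMul t u => ueval f t * ueval f u
  | TScale a t => a *: ueval f t
  end.

Definition lie_morph (A : algType F) (f : 'M[F]_N -> A) : Prop :=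
  forall x y, f (x *m y - y *m x) = f x * f y - f y * f x.

Lemma ueval_eq (A : algType F) (f : {linear 'M[F]_N -> A}) t u :
  lie_morph f -> ueqv t u -> ueval f t = ueval f u.
Proof.
move=> fL; elim=> //=.
- by move=> ? ? ? _ -> _ ->.
- by move=> ? ? _ ->.
- by move=> ? ? ? ? _ -> _ ->.
- by move=> ? ? ? ? _ -> _ ->.
- by move=> ? ? ? _ ->.
- by move=> ? ? ?; rewrite addrA.
- by move=> ? ?; rewrite addrC.
- by move=> ?; rewrite add0r.
- by move=> ?; rewrite addNr.
- by move=> ? ? ?; rewrite mulrA.
- by move=> ?; rewrite mul1r.
- by move=> ?; rewrite mulr1.
- by move=> ? ? ?; rewrite mulrDl.
- by move=> ? ? ?; rewrite mulrDr.
- by move=> ? ? ?; rewrite scalerA.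
- by move=> ?; rewrite scale1r.
- by move=> ? ? ?; rewrite scalerDr.
- by move=> ? ? ?; rewrite scalerDl.
- by move=> ? ? ?; rewrite scalerAl.
- by move=> ? ? ?; rewrite scalerAr.
- by move=> ? ? ?; rewrite linearP.
Qed.

Fact UaddA : associative Uadd.
Proof.
elim/Upi_ind=> t; elim/Upi_ind=> u; elim/Upi_ind=> v.
by rewrite !UpiE; apply/Upi_eq/ueqv_addA.
Qed.
Fact UaddC : commutative Uadd.
Proof.
elim/Upi_ind=> t; elim/Upi_ind=> u.
by rewrite !UpiE; apply/Upi_eq/ueqv_addC.
Qed.
Fact Uadd0 : left_id Uzero Uadd.
Proof. by elim/Upi_ind=> t; rewrite UpiE; apply/Upi_eq/ueqv_add0. Qed.
Fact UaddN : left_inverse Uzero Uopp Uadd.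
Proof. by elim/Upi_ind=> t; rewrite !UpiE; apply/Upi_eq/ueqv_addN. Qed.

HB.instance Definition _ := GRing.isZmodule.Build Ugl UaddA UaddC Uadd0 UaddN.

Lemma UpiN t : - (\pi_Ugl t : Ugl) = \pi_Ugl (TOpp t).
Proof. exact: Upi_opp. Qed.
Lemma UpiD t u : (\pi_Ugl t : Ugl) + \pi_Ugl u = \pi_Ugl (TAdd t u).
Proof. exact: Upi_add. Qed.

Fact UmulA : associative Umul.
Proof.
elim/Upi_ind=> t; elim/Upi_ind=> u; elim/Upi_ind=> v.
by rewrite !UpiE; apply/Upi_eq/ueqv_mulA.
Qed.
Fact Umul1 : left_id Uone Umul.
Proof. by elim/Upi_ind=> t; rewrite UpiE; apply/Upi_eq/ueqv_mul1. Qed.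
Fact U1mul : right_id Uone Umul.
Proof. by elim/Upi_ind=> t; rewrite UpiE; apply/Upi_eq/ueqv_1mul. Qed.
Fact UmulDl : left_distributive Umul +%R.
Proof.
elim/Upi_ind=> t; elim/Upi_ind=> u; elim/Upi_ind=> v.
by rewrite !(UpiE, UpiD); apply/Upi_eq/ueqv_mulDl.
Qed.
Fact UmulDr : right_distributive Umul +%R.
Proof.
elim/Upi_ind=> t; elim/Upi_ind=> u; elim/Upi_ind=> v.
by rewrite !(UpiE, UpiD); apply/Upi_eq/ueqv_mulDr.
Qed.
(* The augmentation separates 1 from 0. *)
Fact U1_neq0 : Uone != 0.
Proof.
have L0 : lie_morph (\0 : 'M[F]_N -> F^o) by move=> x y; rewrite mulr0 subr0.
apply/eqP => /Upi_inv /(@ueval_eq F^o \0 _ _ L0) /eqP /=.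
by rewrite oner_eq0.
Qed.

HB.instance Definition _ := GRing.Zmodule_isNzRing.Build Ugl
  UmulA Umul1 U1mul UmulDl UmulDr U1_neq0.

Lemma UpiM t u : (\pi_Ugl t : Ugl) * \pi_Ugl u = \pi_Ugl (TMul t u).
Proof. exact: Upi_mul. Qed.

Fact UscaleA a b u : Uscale a (Uscale b u) = Uscale (a * b) u.
Proof.
by elim/Upi_ind: u => t; rewrite !UpiE; apply/Upi_eq/ueqv_scaleA.
Qed.
Fact Uscale1 : left_id 1 Uscale.
Proof. by elim/Upi_ind=> t; rewrite !UpiE; apply/Upi_eq/ueqv_scale1. Qed.
Fact UscaleDr : right_distributive Uscale +%R.
Proof.
move=> a; elim/Upi_ind=> t; elim/Upi_ind=> u.
by rewrite !(UpiE, UpiD); apply/Upi_eq/ueqv_scaleDr.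
Qed.
Fact UscaleDl u : {morph Uscale^~ u : a b / a + b}.
Proof.
move=> a b; elim/Upi_ind: u => t.
by rewrite !(UpiE, UpiD); apply/Upi_eq/ueqv_scaleDl.
Qed.

HB.instance Definition _ := GRing.Zmodule_isLmodule.Build F Ugl
  UscaleA Uscale1 UscaleDr UscaleDl.

Lemma UpiZ a t : a *: (\pi_Ugl t : Ugl) = \pi_Ugl (TScale a t).
Proof. exact: Upi_scale. Qed.

Fact UscaleAl (a : F) (u v : Ugl) : a *: (u * v) = (a *: u) * v.
Proof.
elim/Upi_ind: u => t; elim/Upi_ind: v => s.
by rewrite UpiM !UpiZ UpiM; apply/Upi_eq/ueqv_scaleAl.
Qed.
HB.instance Definition _ := GRing.Lmodule_isLalgebra.Build F Ugl UscaleAl.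

Fact UscaleAr (a : F) (u v : Ugl) : a *: (u * v) = u * (a *: v).
Proof.
elim/Upi_ind: u => t; elim/Upi_ind: v => s.
by rewrite UpiM !UpiZ UpiM; apply/Upi_eq/ueqv_scaleAr.
Qed.
HB.instance Definition _ := GRing.Lalgebra_isAlgebra.Build F Ugl UscaleAr.

Definition Uiota (x : 'M[F]_N) : Ugl := \pi_Ugl (TVar x).

Fact Uiota_linear : linear Uiota.
Proof.
move=> a x y; rewrite /Uiota UpiZ UpiD.
exact/Upi_eq/ueqv_linear.
Qed.
HB.instance Definition _ :=
  GRing.isLinear.Build F 'M[F]_N Ugl *:%R Uiota Uiota_linear.

Lemma Uiota_lie : lie_morph Uiota.
Proof.
move=> x y; rewrite /Uiota !UpiM UpiN UpiD.
exact/Upi_eq/ueqv_bracket.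
Qed.

Section Lift.
Variables (A : algType F) (f : {linear 'M[F]_N -> A}) (fL : lie_morph f).

Definition Ulift_fun of lie_morph f : Ugl -> A := fun u => ueval f (repr u).

Let lift := Ulift_fun fL.

Lemma Ulift_pi t : lift (\pi_Ugl t) = ueval f t.
Proof. exact/(ueval_eq fL)/Urepr. Qed.

Fact Ulift_linear : linear lift.
Proof.
move=> a; elim/Upi_ind=> t; elim/Upi_ind=> u.
by rewrite UpiZ UpiD !Ulift_pi.
Qed.
Fact Ulift_monoid : monoid_morphism lift.
Proof.
split; first by rewrite /GRing.one /= Ulift_pi.
elim/Upi_ind=> t; elim/Upi_ind=> u.
by rewrite UpiM !Ulift_pi.
Qed.
HB.instance Definition _ :=
  GRing.isLinear.Build F Ugl A *:%R (Ulift_fun fL) Ulift_linear.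
HB.instance Definition _ :=
  GRing.isMonoidMorphism.Build Ugl A (Ulift_fun fL) Ulift_monoid.

Definition Ulift : {lrmorphism Ugl -> A} := Ulift_fun fL.

Lemma Ulift_iota x : Ulift (Uiota x) = f x.
Proof. exact: Ulift_pi. Qed.
End Lift.

Lemma Uext (A : algType F) (g h : {lrmorphism Ugl -> A}) :
  (forall x, g (Uiota x) = h (Uiota x)) -> g =1 h.
Proof.
move=> gh; elim/Upi_ind; elim.
- exact: gh.
- by rewrite -[\pi_Ugl TZero]/(0 : Ugl) !rmorph0.
- by rewrite -[\pi_Ugl TOne]/(1 : Ugl) !rmorph1.
- by move=> t IHt; rewrite -UpiN !rmorphN /= IHt.
- by move=> t IHt u IHu; rewrite -UpiD !rmorphD /= IHt IHu.
- by move=> t IHt u IHu; rewrite -UpiM !rmorphM /= IHt IHu.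
- by move=> a t IHt; rewrite -UpiZ !linearZ /= IHt.
Qed.

End EnvelopingAlgebra.

(* All indices below are natural numbers counted from 1.                      *)
Section Generators.
Variables (F : fieldType) (N : nat).

(* e_{i,j}; this is 0 unless 1 <= i, j <= N. *)
Definition munit (i j : nat) : 'M[F]_N :=
  \matrix_(a < N, b < N) ((a.+1 == i) && (b.+1 == j))%:R.

Definition Ue (i j : nat) : Ugl F N := Uiota (munit i j).
Definition UH (i : nat) : Ugl F N := Ue i i.
Definition UE (i : nat) : Ugl F N := Ue i i.+1.
Definition UF (i : nat) : Ugl F N := Ue i.+1 i.
Definition UFF (i j : nat) : Ugl F N := Ue j i.
Definition UC (i j : nat) : Ugl F N := UH i - UH j + (j%:R - i%:R).

End Generators.

Arguments Ue {F N} i j.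
Arguments UH {F N} i.
Arguments UE {F N} i.
Arguments UF {F N} i.
Arguments UFF {F N} i j.
Arguments UC {F N} i j.

Lemma munit_delta (F : fieldType) N (a b : 'I_N) :
  munit F N a.+1 b.+1 = delta_mx a b.
Proof. by apply/matrixP=> i j; rewrite !mxE !eqSS. Qed.

Lemma mx_munit (F : fieldType) N (x : 'M[F]_N) :
  x = \sum_(a < N) \sum_(b < N) x a b *: munit F N a.+1 b.+1.
Proof.
rewrite {1}[x]matrix_sum_delta; apply: eq_bigr => a _; apply: eq_bigr => b _.
by rewrite munit_delta.
Qed.

Lemma munit_mul (F : fieldType) N i j k l : (0 < j <= N)%N ->
  munit F N i j *m munit F N k l = (j == k)%:R *: munit F N i l.
Proof.
case: j => // j jN; apply/matrixP=> a b; rewrite !mxE.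
rewrite (bigD1 (Ordinal jN)) //= big1 => [|c /negPf cj].
  rewrite !mxE /= eqxx andbT addr0 -!natrM !mulnb.
  by case: (_ == i); case: (_ == k); case: (_ == l).
rewrite !mxE eqSS; have -> : (c == j :> nat) = false by exact: cj.
by rewrite andbF mul0r.
Qed.

Section Shift.
Variables (F : fieldType) (n : nat).

Definition shift_mx (x : 'M[F]_n) : 'M[F]_(1 + n) :=
  block_mx (0 : 'M_1) (0 : 'M_(1, n)) (0 : 'M_(n, 1)) x.

Definition Ushift_mx (x : 'M[F]_n) : Ugl F n.+1 := Uiota (shift_mx x).

Fact Ushift_mx_linear : linear Ushift_mx.
Proof.
move=> a x y; rewrite /Ushift_mx.
suff -> : shift_mx (a *: x + y) = a *: shift_mx x + shift_mx y by exact: linearP.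
by rewrite /shift_mx scale_block_mx add_block_mx !scaler0 !addr0.
Qed.
HB.instance Definition _ :=
  GRing.isLinear.Build F 'M[F]_n (Ugl F n.+1) *:%R Ushift_mx Ushift_mx_linear.

Fact Ushift_mx_lie : lie_morph Ushift_mx.
Proof.
move=> x y; rewrite /Ushift_mx.
suff -> : shift_mx (x *m y - y *m x) =
    shift_mx x *m shift_mx y - shift_mx y *m shift_mx x by exact: Uiota_lie.
rewrite /shift_mx !mulmx_block !(mul0mx, mulmx0) !(addr0, add0r).
by rewrite opp_block_mx add_block_mx !subr0.
Qed.

Definition Ushift : {lrmorphism Ugl F n -> Ugl F n.+1} := Ulift Ushift_mx_lie.

Lemma Ushift_e i j : (0 < i)%N -> (0 < j)%N -> Ushift (Ue i j) = Ue i.+1 j.+1.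
Proof.
case: i j => [|i] [|j] // _ _; rewrite Ulift_iota; congr Uiota.
apply/matrixP=> a b; rewrite !mxE.
case: splitP => c /= ->; rewrite !mxE; case: splitP => d /= ->; rewrite !mxE.
- by rewrite ord1.
- by rewrite ord1.
- by rewrite [d]ord1 andbF.
- by rewrite !add1n !eqSS.
Qed.

Lemma Ushift_E i : (0 < i)%N -> Ushift (UE i) = UE i.+1.
Proof. by move=> i0; rewrite Ushift_e. Qed.
Lemma Ushift_F i : (0 < i)%N -> Ushift (UF i) = UF i.+1.
Proof. by move=> i0; rewrite Ushift_e. Qed.
Lemma Ushift_H i : (0 < i)%N -> Ushift (UH i) = UH i.+1.
Proof. by move=> i0; rewrite Ushift_e. Qed.

End Shift.

(* Only n >= 1 matters. In the recursive case n = m + 1 with m >= 1, so that   *)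
(* n - 1 is m and n - 2 is m.-1.                                              *)
Fixpoint Psibar (F : fieldType) (n : nat) : Ugl F n.+1 :=
  match n with
  | 0 => 0
  | m.+1 =>
    if m is 0 then UF 1 else
      UF 1 * Ushift F m.+1 (Psibar F m) * (UH 2 - UH m.+2 + m%:R)
      - Ushift F m.+1 (Psibar F m) * UF 1 * (UH 2 - UH m.+2 + m.-1%:R)
  end.

(* The entry in row s and column t. *)
Definition carter_entry (F : fieldType) (n s t : nat) : Ugl F n.+1 :=
  if (s <= t)%N then UFF s t.+1
  else if s == t.+1 then - UC 1 s
  else 0.

Definition carter_mx (F : fieldType) (n : nat) : 'M[Ugl F n.+1]_n :=
  \matrix_(a < n, b < n) carter_entry F n a.+1 b.+1.

(* \det is the Leibniz sum with factors in order of rows, over any ring. *)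
Definition carterS (F : fieldType) (n : nat) : Ugl F n.+1 :=
  \det (carter_mx F n).

(* Existence of the automorphism sigma_n. It is induced by the Lie algebra    *)
(* automorphism e_{i,j} |-> (-1)^(i+j+1) e_{N+1-j,N+1-i}, where N = n + 1.    *)
Section Sigma.
Variables (F : fieldType) (N : nat).

Definition flip_mx (x : 'M[F]_N) : 'M[F]_N :=
  \matrix_(a, b) ((-1) ^+ (a + b).+1 * x (rev_ord b) (rev_ord a)).

Definition Uflip_mx (x : 'M[F]_N) : Ugl F N := Uiota (flip_mx x).

Fact flip_mx_linear : linear flip_mx.
Proof. by move=> a x y; apply/matrixP=> i j; rewrite !mxE mulrDr mulrCA. Qed.

Fact Uflip_mx_linear : linear Uflip_mx.
Proof. by move=> a x y; rewrite /Uflip_mx flip_mx_linear linearP. Qed.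
HB.instance Definition _ :=
  GRing.isLinear.Build F 'M[F]_N (Ugl F N) *:%R Uflip_mx Uflip_mx_linear.

Lemma flip_mx_mul x y : flip_mx (x *m y) = - (flip_mx y *m flip_mx x).
Proof.
apply/matrixP=> a b; rewrite !mxE mulr_sumr -sumrN (reindex_inj rev_ord_inj) /=.
apply: eq_bigr => c _; rewrite !mxE mulrACA -exprD [y _ _ * _]mulrC -mulNr.
congr (_ * _); rewrite -signr_odd -[in RHS]signr_odd -signrN.
by rewrite !addSn !addnS /= !negbK !oddD; case: (odd a) (odd b) (odd c) => [] [] [].
Qed.

Fact Uflip_mx_lie : lie_morph Uflip_mx.
Proof.
move=> x y; rewrite /Uflip_mx -Uiota_lie.
suff -> : flip_mx (x *m y - y *m x) =
    flip_mx x *m flip_mx y - flip_mx y *m flip_mx x by [].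
have -> : flip_mx (x *m y - y *m x) = flip_mx (x *m y) - flip_mx (y *m x).
  by rewrite addrC -scaleN1r flip_mx_linear scaleN1r addrC.
by rewrite !flip_mx_mul opprK addrC.
Qed.

Definition Uflip : {lrmorphism Ugl F N -> Ugl F N} := Ulift Uflip_mx_lie.

Lemma Uflip_iota x : Uflip (Uiota x) = Uiota (flip_mx x).
Proof. exact: Ulift_iota. Qed.

Lemma Uflip_e i j : (0 < i <= N)%N -> (0 < j <= N)%N ->
  Uflip (Ue i j) = (-1) ^+ (i + j).+1 *: Ue (N.+1 - j) (N.+1 - i).
Proof.
move=> iN jN; rewrite Uflip_iota -linearZ /=; congr Uiota.
apply/matrixP=> a b; rewrite !mxE.
have -> : ((N - b.+1).+1 == i) = (b.+1 == N.+1 - i)%N.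
  by have := ltn_ord b; lia.
have -> : ((N - a.+1).+1 == j) = (a.+1 == N.+1 - j)%N.
  by have := ltn_ord a; lia.
rewrite andbC; case: andP => [[/eqP aj /eqP bi]|]; last by rewrite !mulr0.
rewrite !mulr1 -signr_odd -[in RHS]signr_odd; congr (_ ^+ (nat_of_bool _)).
by lia.
Qed.

Lemma UflipK : involutive Uflip.
Proof.
apply: (@Uext F N (Ugl F N) (Uflip \o Uflip) idfun) => x /=.
rewrite !Uflip_iota; congr Uiota.
apply/matrixP=> a b; rewrite !mxE !rev_ordK mulrA -exprD.
rewrite -signr_odd (_ : odd _ = false) ?mul1r //=.
by have := ltn_ord a; have := ltn_ord b; lia.
Qed.
End Sigma.

Lemma sigma_exists (F : fieldType) (n : nat) :
  exists sigma : {lrmorphism Ugl F n.+1 -> Ugl F n.+1},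
    [/\ bijective sigma,
        forall i, (1 <= i <= n)%N -> sigma (UE i) = UE (n.+1 - i),
        forall i, (1 <= i <= n)%N -> sigma (UF i) = UF (n.+1 - i) &
        forall j, (1 <= j <= n.+1)%N -> sigma (UH j) = - UH (n.+2 - j)].
Proof.
exists (Uflip F n.+1); split.
- by exists (Uflip F n.+1); apply: UflipK.
- move=> i i_n; rewrite Uflip_e; try lia.
  rewrite -signr_odd (_ : odd _ = false) ?scale1r; last lia.
  by rewrite /UE; congr Ue; lia.
- move=> i i_n; rewrite Uflip_e; try lia.
  rewrite -signr_odd (_ : odd _ = false) ?scale1r; last lia.
  by rewrite /UF; congr Ue; lia.
- move=> j j_n; rewrite Uflip_e; try lia.
  by rewrite -signr_odd (_ : odd _ = true) ?scaleN1r; last lia.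
Qed.

(* Main.v *)
Require Import Defs.
From mathcomp Require Import all_boot all_order all_fingroup all_algebra.
From mathcomp Require Import zify.

Import GRing.Theory.
Local Open Scope ring_scope.

(* Composing sigma with the shift yields the analogous map for n - 1, so the
   recursion for Psibar becomes, with S_n = S_{1,n},
     S_{n+1} = S_n F_n + [F_n, S_n] C_{1,n}.
   This is the expansion of the determinant S_{n+1} along its last row, whose
   only nonzero entries are F_n and - C_{1,n}: the minor of the latter is the
   determinant S_n with its last column (e_{n,s})_s replaced by (e_{n+1,s})_s,
   and this is [F_n, S_n] because ad F_n is a derivation that kills all the
   other columns and maps e_{n,s} to e_{n+1,s}. *)

(** Permutations are sorted by the image of [i]; injectivity suffices since (n+1) n! = (n+1)!. *)
Lemma lift_perm_pair_bij (n : nat) (i : 'I_n.+1) :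
  bijective (fun p : 'I_n.+1 * 'S_n => lift_perm i p.1 p.2).
Proof.
apply: inj_card_bij => [[j s] [k t] /= jskt|].
  have jk : j = k by rewrite -(lift_perm_id i j s) jskt lift_perm_id.
  rewrite -jk in jskt *; congr pair; apply/permP => l; apply: (@lift_inj _ j).
  by rewrite -!(lift_perm_lift i) jskt.
by rewrite card_prod card_ord !card_Sn factS.
Qed.

Lemma widen_ord_max (n : nat) (i : 'I_n) :
  widen_ord (leqnSn n) i = lift ord_max i.
Proof. by apply: ord_inj; rewrite lift_max. Qed.

(* The entries of the last row are already the rightmost factors, so
   commutativity is not needed. *)
Lemma det_expand_last_row (R : pzRingType) (n : nat) (A : 'M[R]_n.+1) :
  \det A = \sum_(j < n.+1) (-1) ^+ (n + j)
             * \det (row' ord_max (col' j A)) * A ord_max j.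
Proof.
rewrite /determinant (reindex _ (onW_bij _ (lift_perm_pair_bij n ord_max))).
rewrite -(pair_bigA _ (fun j s =>
  (-1) ^+ lift_perm ord_max j s * \prod_i A i (lift_perm ord_max j s i))) /=.
apply: eq_bigr => j _; rewrite mulr_sumr mulr_suml; apply: eq_bigr => s _.
rewrite big_ord_recr /= lift_perm_id odd_lift_perm !mulrA; congr (_ * _ * _).
  by rewrite -[(-1) ^+ (n + j)]signr_odd oddD -signr_addb.
by apply: eq_bigr => i _; rewrite !mxE widen_ord_max lift_perm_lift.
Qed.

(** Leibniz rule for ad [f]: it kills every factor but the [k]-th, so one term survives. *)
Lemma commutator_prod (R : pzRingType) (f : R) (n : nat) (x y : 'I_n -> R)
    (k : 'I_n) :
  (forall i, i != k -> f * x i = x i * f /\ y i = x i) ->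
  f * x k - x k * f = y k ->
  f * \prod_i x i - \prod_i x i * f = \prod_i y i.
Proof.
elim: n x y k => [|n IHn] x y k xy xyk; first by case: k {xy xyk}.
rewrite !big_ord_recr /=; case: (unliftP ord_max k) xy xyk => [j|] -> xy xyk.
  have [fx ->] := xy _ (neq_lift ord_max j).
  rewrite mulrA -[in X in _ - X]mulrA -fx mulrA -mulrBl; congr (_ * _).
  apply: (IHn _ _ j) => [i ij|]; last by rewrite widen_ord_max.
  by rewrite !widen_ord_max; apply: xy; rewrite (inj_eq lift_inj).
have -> : \prod_(i < n) y (widen_ord (leqnSn n) i) =
          \prod_(i < n) x (widen_ord (leqnSn n) i).
  by apply: eq_bigr => i _; rewrite !widen_ord_max;
    case: (xy (lift ord_max i)) => //; rewrite eq_sym neq_lift.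
(* With the special factor last, it remains to move [f] past all the others. *)
rewrite -xyk mulrBr !mulrA; congr (_ * _ - _).
have : forall i, f * x (lift ord_max i) = x (lift ord_max i) * f.
  by move=> i; case: (xy (lift ord_max i)) => //; rewrite eq_sym neq_lift.
move=> fx; apply: (big_ind (fun z => f * z = z * f)) => [|a b fa fb|i _].
- by rewrite mulr1 mul1r.
- by rewrite mulrA fa -!mulrA fb.
- by rewrite widen_ord_max.
Qed.

(** Each Leibniz term has exactly one factor from column [k], in row [s^-1 k]. *)
Lemma commutator_det (R : pzRingType) (f : R) (n : nat) (A B : 'M[R]_n)
    (k : 'I_n) :
  (forall i j, j != k -> f * A i j = A i j * f /\ B i j = A i j) ->
  (forall i, f * A i k - A i k * f = B i k) ->
  f * \det A - \det A * f = \det B.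
Proof.
move=> AB ABk; rewrite /determinant mulr_sumr mulr_suml -sumrB.
apply: eq_bigr => s _.
have <- := @commutator_prod R f n (fun i => A i (s i)) (fun i => B i (s i))
             (s^-1%g k).
- by rewrite mulrBr !mulrA -signr_odd commr_sign.
- by move=> i ik; apply: AB; rewrite -(inj_eq (@perm_inj _ s^-1%g)) permK.
- by rewrite permKV.
Qed.

(** The bounds concern the contracted indices: out of range [munit] is 0, and e_{i,j} e_{j,l} =
    e_{i,l} could fail. *)
Lemma Ue_bracket (F : fieldType) (N i j k l : nat) :
  (0 < j <= N)%N -> (0 < l <= N)%N ->
  Ue i j * Ue k l - Ue k l * Ue i j
    = (j == k)%:R *: Ue i l - (l == i)%:R *: Ue k j :> Ugl F N.
Proof.
move=> jN lN; rewrite -Uiota_lie !munit_mul // -!linearZ -linearB.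
by rewrite !linearB.
Qed.

Section CarterRecursion.
Variables (F : fieldType) (N : nat).

(* The determinant defining S_{1,n+1}, read in gl_(N+1) for any N >= n through
   the upper left corner embedding. *)
Definition carter_mx_in (n : nat) : 'M[Ugl F N.+1]_n :=
  \matrix_(a < n, b < n) carter_entry F N a.+1 b.+1.

Lemma Ue_commute (i j k l : nat) : (0 < j <= N.+1)%N -> (0 < l <= N.+1)%N ->
  j != k -> l != i -> Ue i j * Ue k l = Ue k l * Ue i j :> Ugl F N.+1.
Proof.
move=> jN lN /negPf jk /negPf li; apply/eqP; rewrite -subr_eq0.
by rewrite Ue_bracket // jk li !scale0r subr0.
Qed.

Lemma det_carter_mx_inS (n : nat) : (n.+2 <= N)%N ->
  let S := \det (carter_mx_in n.+1) in
  \det (carter_mx_in n.+2) =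
    S * UF n.+2 + (UF n.+2 * S - S * UF n.+2) * UC 1 n.+2.
Proof.
move=> nN S; rewrite det_expand_last_row 2!big_ord_recr /= big1 => [|j _].
  rewrite add0r addrC; congr (_ + _).
    rewrite -signr_odd addnn odd_double mul1r !mxE /carter_entry leqnn.
    congr (\det _ * _); apply/matrixP => a b.
    by rewrite !mxE !lift_max.
  (* The cofactor sign -1 of column n+1 cancels the sign of the entry -C_{1,n+2}. *)
  rewrite -signr_odd addSn addnn /= odd_double !mxE /carter_entry.
  rewrite ltnn eqxx expr1 mulN1r mulrNN; congr (_ * _).
  apply/esym/(commutator_det _ _ _ _ _ ord_max) => [i j jn|i].
    have ltjn : (j < n)%N by rewrite ltn_neqAle -ltnS ltn_ord andbT; exact: jn.
    have lin := ltn_ord i.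
    split; last first.
      by rewrite !mxE lift_max /= /bump leqNgt ltjn.
    rewrite !mxE /carter_entry; case: ifP => ij.
      by apply: Ue_commute; lia.
    case: ifP => [ijE|_]; last by rewrite mulr0 mul0r.
    (* The entry is -C_{1,i+1} with i+1 <= n+1, so its H's commute with F_{n+2} = e_{n+3,n+2}. *)
    rewrite mulrN mulNr /UC /UH mulrDr mulrDl mulrBr mulrBl.
    rewrite !(Ue_commute n.+3) //; try lia.
    by congr (- (_ + _)); apply: commrB; apply: commr_nat.
  (* Deleting column n+1 puts column n+2 in its place, with entries e_{n+3,i+1}. *)
  rewrite !mxE lift_max /= /bump leqnn add1n /carter_entry.
  have lin := ltn_ord i.
  rewrite !ifT; try lia.
  rewrite Ue_bracket; try lia.
  rewrite eqxx scale1r (_ : (i.+1 == n.+3) = false) ?scale0r ?subr0 //.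
  by lia.
rewrite !mxE /carter_entry /=; have jn := ltn_ord j.
rewrite !ifF ?mulr0 //; lia.
Qed.

(** The induction composes [g] with the shift, which lowers the source but keeps the target; hence
    [N] is independent of [n]. *)
Lemma morph_Psibar (n : nat) (g : {lrmorphism Ugl F n.+2 -> Ugl F N.+1}) :
  (n < N)%N ->
  (forall i, (1 <= i <= n.+1)%N -> g (UF i) = UF (n.+2 - i)) ->
  (forall j, (1 <= j <= n.+2)%N -> g (UH j) = - UH (n.+3 - j)) ->
  g (Psibar F n.+1) = \det (carter_mx_in n.+1).
Proof.
elim: n g => [|n IHn] g nN gF gH.
  rewrite /determinant (big_pred1 1%g) => [|s]; last by rewrite [s]permS1 /= eqxx.
  by rewrite big_ord1 odd_perm1 perm1 mul1r mxE gF.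
rewrite det_carter_mx_inS //; set S := \det _.
have gS : g (Ushift F n.+2 (Psibar F n.+1)) = S.
  apply: (IHn (g \o Ushift F n.+2)) => [|i i_n|j j_n] /=; first exact: ltnW.
    by rewrite Ushift_F ?gF; [congr UF|..]; lia.
  by rewrite Ushift_H ?gH; [congr (- UH _)|..]; lia.
rewrite /Psibar -/(Psibar F n.+1) rmorphB !rmorphM !rmorphD !rmorphN /=.
rewrite !rmorph_nat gS gF // !gH; try lia.
rewrite !subSS !subn0 subSnn opprK [- _ + UH 1]addrC.
have defC : UH 1 - UH n.+2 + n.+1%:R = UC 1 n.+2 :> Ugl F N.+1.
  by rewrite /UC -natrB // subSS subn0.
have -> : UH 1 - UH n.+2 + n%:R = UC 1 n.+2 - 1 :> Ugl F N.+1.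
  by rewrite -defC -natr1 addrA addrK.
rewrite defC.
(* With C = C_{1,n+2} and F = F_{n+2}: F S C - S F (C - 1) = S F + (F S - S F) C. *)
by rewrite mulrBr mulr1 mulrBl opprB addrCA.
Qed.

End CarterRecursion.

Theorem theorem9p6 (F : fieldType) (charF0 : [pchar F] =i pred0)
    (n : nat) (n_ge1 : (1 <= n)%N)
    (sigma : {lrmorphism Ugl F n.+1 -> Ugl F n.+1})
    (sigma_auto : bijective sigma)
    (sigmaE : forall i : nat, (1 <= i <= n)%N -> sigma (UE i) = UE (n.+1 - i))
    (sigmaF : forall i : nat, (1 <= i <= n)%N -> sigma (UF i) = UF (n.+1 - i))
    (sigmaH : forall j : nat, (1 <= j <= n.+1)%N ->
       sigma (UH j) = - UH (n.+2 - j)) :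
  sigma (Psibar F n) = carterS F n.
Proof.
(* When [N] is the matrix size, [carter_mx_in] is [carter_mx] by conversion. *)
by case: n n_ge1 sigma {sigma_auto sigmaE} sigmaF sigmaH => // n _ sigma;
  apply: morph_Psibar.
Qed.
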